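(* Let $g(n)$ denote the minimum of $s[(G,f)]$ over all SED-pairs $(G,f)$ of order $n$. Then: (i) For every positive integer $n$, $g(n) \geq -\frac{n^2}{25}$. (ii) Let $n = 4(p+q)p+1$, where $p$ and $q$ are positive integers satisfying $p^2 = 2q^2+1$. Then there is a SED-pair $(G,f)$ of order $n$ with \[ s[(G,f)] < -(1+o(1))\frac{n^2}{8(1+\sqrt{2})^2}, \] i.e. there is a function $\varepsilon(n)$ with $\varepsilon(n)\to 0$ as $n\to\infty$ along such values of $n$, such that for each such $n$ there is a SED-pair $(G,f)$ of order $n$ with $s[(G,f)] < -(1+\varepsilon(n))\frac{n^2}{8(1+\sqrt{2})^2}$.
   Context: All graphs are finite, simple and undirected; $G=(V,E)$. For an edge $e=(u,v)$, its closed edge-neighborhood $N[e]$ is the set consisting of $e$ and all edges of $G$ sharing an endpoint with $e$. A function $f: E \to \{+1,-1\}$ is a signed edge domination function of $G$ if $\sum_{e' \in N[e]} f(e') \geq 1$ for every $e \in E$; in this case $(G,f)$ is called a SED-pair of order $|V|$. For such a pair, $s[(G,f)] = \sum_{e\in E} f(e)$. *)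

(* Defs.v *)
From HB Require Import structures.
From mathcomp Require Import all_boot all_order all_algebra.
From mathcomp Require Import all_classical all_reals all_analysis.
From mathcomp Require Import zify.

Set Implicit Arguments.
Unset Strict Implicit.
Unset Printing Implicit Defensive.

Import Order.TTheory GRing.Theory Num.Theory.
Import numFieldNormedType.Exports.
Local Open Scope ring_scope.

Record sgraph (T : finType) := SGraph {
  adj : rel T;
  adj_sym : symmetric adj;
  adj_irr : irreflexive adj
}.

Section Graph.
Variables (T : finType) (G : sgraph T).

Definition edges : {set {set T}} :=
  [set e : {set T} | [exists u, exists v, adj G u v && (e == [set u; v])]].

Definition closed_edge_nbhd (e : {set T}) : {set {set T}} :=
  [set e' in edges | (e' == e) || (e' :&: e != finset.set0)].

(* [f] represents a map from the edges to {+1, -1}; its values on sets of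
   vertices that are not edges play no role. *)
Definition is_sed_fun (f : {set T} -> int) : Prop :=
  (forall e, e \in edges -> f e = 1 \/ f e = -1) /\
  (forall e, e \in edges -> 1 <= \sum_(e' in closed_edge_nbhd e) f e').

End Graph.

Record sed_pair := SedPair {
  sed_vertex : finType;
  sed_graph : sgraph sed_vertex;
  sed_fun : {set sed_vertex} -> int;
  sed_funP : is_sed_fun sed_graph sed_fun
}.

Arguments sed_fun : clear implicits.
Arguments sed_funP : clear implicits.

Definition sed_order (P : sed_pair) : nat := #|sed_vertex P|.

Definition sed_sum (P : sed_pair) : int :=
  \sum_(e in edges (sed_graph P)) sed_fun P e.

Definition is_min_sed_sum (n : nat) (m : int) : Prop :=
  (exists P : sed_pair, sed_order P = n /\ sed_sum P = m) /\
  (forall P : sed_pair, sed_order P = n -> m <= sed_sum P).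

(* The minimum exists for every [n] (lemma [g_is_min]), so the default value
   of [xget] is never used. *)
Definition g (n : nat) : int := xget 0 (is_min_sed_sum n).

Lemma sed_sum_ge (P : sed_pair) : - (2 ^ sed_order P)%N%:Z <= sed_sum P.
Proof.
have -> : (2 ^ sed_order P)%N = #|{set sed_vertex P}|.
  by rewrite -cardsT -powersetT card_powerset cardsT.
apply: (@le_trans _ _ (\sum_(e in edges (sed_graph P)) (- 1 : int))).
  rewrite sumr_const mulNrn lerN2 -[X in _ <= X]natz ler_nat.
  exact: max_card.
by apply: ler_sum => e /(proj1 (sed_funP P)) [] ->.
Qed.

Lemma sed_pair_exists n : exists P : sed_pair, sed_order P = n.
Proof.
pose G := @SGraph 'I_n (fun _ _ => false) (fun _ _ => erefl) (fun _ => erefl).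
have E0 e : e \in edges G -> False by rewrite inE => /existsP[u] /existsP[v].
have GP : is_sed_fun G (fun=> 1) by split=> e /E0.
by exists (SedPair GP); rewrite /sed_order card_ord.
Qed.

Lemma g_is_min n : is_min_sed_sum n (g n).
Proof.
apply: xgetPex; pose b : int := (2 ^ n)%N%:Z.
pose A k := exists P, sed_order P = n /\ sed_sum P = k%:Z - b.
have AP P : sed_order P = n -> A (absz (sed_sum P + b)).
  by move=> Pn; exists P; split=> //; have := sed_sum_ge P; rewrite Pn; lia.
have exA : exists k, `[< A k >].
  by have [P /AP PA] := sed_pair_exists n; exists (absz (sed_sum P + b)); apply/asboolP.
case: (ex_minnP exA) => k /asboolP Ak kmin; exists (k%:Z - b); split=> // P Pn.
have /asboolP /kmin := AP P Pn.
by have := sed_sum_ge P; rewrite Pn; lia.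
Qed.

Definition pell_order (n : nat) : Prop :=
  exists p q : nat, [/\ (0 < p)%N, (0 < q)%N, (p ^ 2 = 2 * q ^ 2 + 1)%N
                      & n = (4 * (p + q) * p + 1)%N].

(* Main.v *)
(** Write [s u] for the signed degree of [u]: the hypothesis says
    [1 + f uv <= s u + s v] on every edge [uv], and the total weight is half of
    the sum of [s].

    Lower bound: the vertices with [s u < 0] are pairwise non-adjacent.  If the
    least signed degree is [-k < 0], a vertex attaining it has at least [k]
    negative edges, each leading to a vertex of signed degree at least [k], so
    the nonnegative signed degrees add up to [S >= k^2].  If [a] vertices have
    nonnegative signed degree, the negative ones add up to [- M] with
    [M <= (n - a) k], and [S + M], which counts the signed pairs inside the
    nonnegative part, is at most [a^2].  These inequalities force
    [S - M >= - 2 n^2 / 25].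

    Construction: take a positive clique [K] of [2pq] vertices, a set [R] of
    [2p^2] vertices joined positively to all of [K] and carrying an almost
    [2pq]-regular negative graph, a set [N] of [2p(p+q)] vertices each joined
    negatively to [2q^2] vertices of [K], evenly, and one isolated vertex.  The
    signed degrees are [p^2] on [K], [0] or [1] on [R] and [- 2 q^2] on [N],
    whence a total of [- p^4 + O(p^2)]. *)

Require Import Defs.
From HB Require Import structures.
From mathcomp Require Import all_boot all_order all_algebra.
From mathcomp Require Import all_classical all_reals all_analysis.
From mathcomp Require Import zify ring lra.

Set Implicit Arguments.
Unset Strict Implicit.
Unset Printing Implicit Defensive.

Import Order.TTheory GRing.Theory Num.Theory.
Import numFieldNormedType.Exports.
Local Open Scope ring_scope.

(** * Signed degrees of a signed graph *)

Section EdgeSums.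
Variables (T : finType) (G : sgraph T) (f : {set T} -> int).

(** Extending [f] by 0 to non-adjacent pairs makes the row sum at [u] the signed degree of [u]. *)
Definition edge_weight (u v : T) : int :=
  if adj G u v then f [set u; v] else 0.

Lemma edge_weightC u v : edge_weight u v = edge_weight v u.
Proof. by rewrite /edge_weight adj_sym finset.setUC. Qed.

Lemma edgesP (e : {set T}) :
  reflect (exists u v, adj G u v /\ e = [set u; v]) (e \in edges G).
Proof.
rewrite inE; apply: (iffP existsP) => [[u /existsP[v /andP[uv /eqP->]]]|].
  by exists u, v.
by move=> [u [v [uv ->]]]; exists u; apply/existsP; exists v; rewrite uv eqxx.
Qed.

Lemma adj_neq u v : adj G u v -> u != v.
Proof. by apply: contraTneq => ->; rewrite adj_irr. Qed.

Lemma card_edge (e : {set T}) : e \in edges G -> #|e| = 2.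
Proof. by case/edgesP => u [v [/adj_neq uv ->]]; rewrite cards2 uv. Qed.

Lemma edge_eq (e : {set T}) u v :
  e \in edges G -> u != v -> u \in e -> v \in e -> e = [set u; v].
Proof.
move=> /card_edge e2 uv ue ve; apply/esym/eqP.
by rewrite eqEcard e2 cards2 uv andbT finset.subUset !finset.sub1set ue.
Qed.

Lemma sum_incident u :
  \sum_(e in edges G | u \in e) f e = \sum_v edge_weight u v.
Proof.
rewrite -big_mkcond /=.
rewrite (eq_bigl (fun e => e \in (fun v => [set u; v]) @: [set v | adj G u v])).
  rewrite big_imset /=; first by apply: eq_bigl => v; rewrite inE.
  move=> v w; rewrite !inE => uv _ vw.
  have : v \in [set u; w] by rewrite -vw !inE eqxx orbT.
  by rewrite !inE eq_sym (negbTE (adj_neq uv)) => /eqP.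
move=> e; apply/andP/imsetP => [[eE ue]|[v]].
  have [x [y [xy exy]]] := edgesP e eE; move: ue; rewrite exy !inE.
  case/orP=> /eqP ->; first by exists y; rewrite ?inE.
  by exists x; rewrite ?inE 1?adj_sym // finset.setUC.
rewrite inE => uv ->; split; last by rewrite !inE eqxx.
by apply/edgesP; exists u, v.
Qed.

(** Inclusion-exclusion: an edge other than [uv] contains at most one of [u] and [v], so only [uv]
    itself is counted twice. *)
Lemma sum_closed_edge_nbhd u v : adj G u v ->
  \sum_(e in closed_edge_nbhd G [set u; v]) f e =
  \sum_w edge_weight u w + \sum_w edge_weight v w - edge_weight u v.
Proof.
move=> uv; have uvE : [set u; v] \in edges G by apply/edgesP; exists u, v.
rewrite -!sum_incident {1}/edge_weight uv.
have -> : f [set u; v] = \sum_(e in edges G | e == [set u; v]) f e.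
  rewrite (big_pred1 [set u; v]) // => e /=.
  by case: eqP => [->|]; rewrite ?andbT ?andbF.
rewrite [in LHS]big_mkcond !big_mkcondr [in RHS]big_mkcond /=.
rewrite [X in _ = _ + X - _]big_mkcond [X in _ = _ - X]big_mkcond /=.
rewrite -big_split -sumrB; apply: eq_bigr => e _; rewrite inE.
case: ifPn => [/andP[eE]|]; last first.
  case: (boolP (e \in edges G)) => [eE|]; last by rewrite /= ?addr0 ?subr0.
  rewrite negb_or negbK /= => /andP[/negbTE-> /eqP e0].
  have nin x : x \in [set u; v] -> x \in e -> False.
    by move=> xuv xe; have := finset.in_set0 x; rewrite -e0 inE xuv xe.
  by do 2?[case: ifP => [/nin|_]; first by rewrite !inE eqxx ?orbT => /(_ isT)].
rewrite eE; case: eqVneq => [->|neq /=].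
  by rewrite !inE !eqxx orbT /= addrK.
case/finset.set0Pn => x; rewrite !inE => /andP[xe /orP[]/eqP xE];
  move: xe; rewrite {x}xE => xe; rewrite xe.
  case: ifP => [ve|_]; last by rewrite /= ?addr0 ?subr0.
  by rewrite (edge_eq eE (adj_neq uv) xe ve) eqxx in neq.
case: ifP => [ue|_]; last by rewrite add0r subr0.
by rewrite (edge_eq eE (adj_neq uv) ue xe) eqxx in neq.
Qed.

Lemma sum_edge_weight :
  \sum_u \sum_v edge_weight u v = 2 * \sum_(e in edges G) f e.
Proof.
under eq_bigr do rewrite -sum_incident.
rewrite (exchange_big_dep (mem (edges G))) /=; last by move=> u e _ /andP[].
rewrite mulr_sumr; apply: eq_bigr => e eE.
rewrite (eq_bigl (mem e)) => [|u]; last by rewrite /= eE.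
by rewrite sumr_const card_edge // mulr_natl.
Qed.

End EdgeSums.

(** * The lower bound *)

(* Scaled by [n], the extremal point is [a = 2/5], [k = 1/5]. *)
Lemma sed_numeric_bound (F : realFieldType) (n a k S M : F) :
  0 <= n -> 0 <= a -> 0 <= k -> a <= n ->
  k ^+ 2 <= S -> M <= (n - a) * k -> S + M <= a ^+ 2 ->
  - (2 * n ^+ 2) <= 25 * (S - M).
Proof.
move=> n0 a0 k0 an kS MS SM; rewrite leNgt; apply/negP => lt.
(* The hypotheses give S - M >= 2 k^2 - a^2, and 2 t^2 - a^2 = (a - 2n/5)^2 - 2n^2/25, so k >= t >=
   0 would already yield the bound. *)
pose t := a - n / 5.
have kt : k < t.
  rewrite ltNge; apply/negP => tk; rewrite /t in tk.
  case: (leP (a - n / 5) 0) => h.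
    by nra.
  have : (a - n / 5) ^+ 2 <= k ^+ 2 by nra.
  have := sqr_ge0 (a - n * 2 / 5); nra.
have aE : a = t + n / 5 by rewrite /t; lra.
rewrite aE in a0 an MS SM.
(* Now S - M >= k^2 - (n - a) k, a quadratic in [k] with the value 2 (t - n/5)^2 - 2n^2/25 at both k
   = t and k = 4n/5 - 2t. *)
case: (leP k (4 / 5 * n - 2 * t)) => h.
  have : 0 <= (t - k) * (4 / 5 * n - 2 * t - k) by apply: mulr_ge0; lra.
  have := sqr_ge0 (t - n / 5); nra.
(* Here 4n/5 - 2t < k < t, so t > 4n/15, and even the minimum -(4n/5 - t)^2 / 4 of the quadratic is
   at least -16 n^2 / 225. *)
have := sqr_ge0 (4 / 5 * n - t - 2 * k).
have : (4 / 5 * n - t) ^+ 2 <= (8 / 15 * n) ^+ 2 by nra.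
nra.
Qed.

Lemma sed_weight_bound (T : finType) (w : T -> T -> int) :
  (forall u v, w u v = w v u) -> (forall u v, `|w u v| <= 1) ->
  (forall u v, w u v != 0 ->
     1 + w u v <= \sum_x w u x + \sum_x w v x) ->
  - (2 * #|T|%:Z ^+ 2) <= 25 * \sum_u \sum_v w u v.
Proof.
move=> wC w1 wP; pose s u : int := \sum_v w u v.
pose N := [set u | s u < 0].
case: (finset.set_0Vmem N) => [N0|[u0 u0N]].
  have : 0 <= \sum_u s u.
    apply: sumr_ge0 => u _; rewrite leNgt; apply/negP => su.
    by have := finset.in_set0 u; rewrite -N0 inE su.
  by move=> s_ge0; apply: (@le_trans _ _ 0); rewrite ?mulr_ge0 ?oppr_le0 ?mulr_ge0 ?sqr_ge0.
have [m _ mmin] := @Order.TotalTheory.arg_minP _ _ _ u0 xpredT s isT.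
have sm0 : s m < 0 by move: u0N; rewrite inE; apply: le_lt_trans; apply: mmin.
pose k : int := - s m.
pose K := [set v | w m v == -1].
have wge u v : -1 <= w u v <= 1 by rewrite -ler_norml.
have kK : k <= #|K|%:Z.
  rewrite /k lerNl -[#|K|%:Z]natz -sumr_const -sumrN big_mkcond /=.
  apply: ler_sum => v _; rewrite inE; have := wge m v.
  by case: eqP; lia.
have Ks v : v \in K -> k <= s v.
  rewrite inE => /eqP wmv; have := wP m v; rewrite wmv => /(_ isT).
  by rewrite -/(s m) -/(s v) /k; lia.
pose S : int := \sum_(u in ~: N) s u; pose M : int := - \sum_(u in N) s u.
have SM : \sum_u s u = S - M.
  rewrite (bigID (mem N)) /= /S /M opprK addrC; congr (_ + _).
  by apply: eq_bigl => u; rewrite finset.in_setC.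
have kS : k ^+ 2 <= S.
  have : k * #|K|%:Z <= \sum_(u in K) s u.
    by rewrite -[#|K|%:Z]natz mulr_natr -sumr_const; apply: ler_sum.
  have : \sum_(u in K) s u <= S.
    rewrite big_mkcond /S [X in _ <= X]big_mkcond; apply: ler_sum => u _.
    case: ifP => [/Ks|_]; rewrite !inE -leNgt; first by case: ifP; rewrite /k; lia.
    by case: ifP.
  by rewrite /k in kK *; nia.
have MN : M <= (#|T|%:Z - #|~: N|%:Z) * k.
  have -> : #|T|%:Z - #|~: N|%:Z = #|N|%:Z by have := cardsC N; lia.
  rewrite /M -sumrN mulrC -[#|N|%:Z]natz mulr_natr -sumr_const.
  by apply: ler_sum => u _; rewrite /k lerN2; apply: mmin.
have SMle : S + M <= #|~: N|%:Z ^+ 2.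
  have -> : S + M = \sum_(u in ~: N) \sum_(v in ~: N) w u v.
    (* [N] is independent: two negative signed degrees add up to at most -2, while 1 + w u v >= 0.
       So [M] only counts pairs between [N] and its complement. *)
    have -> : M = - \sum_(u in ~: N) \sum_(v in N) w u v.
      rewrite /M; congr (- _); rewrite [RHS]exchange_big /=.
      apply: eq_bigr => u uN.
      rewrite /s (bigID (mem N)) /= big1 ?add0r => [|v vN].
        by apply: eq_big => v; rewrite ?finset.in_setC.
      apply/eqP; apply: contraT => /wP; move: uN vN; rewrite !inE /s.
      by have := wge u v; lia.
    rewrite /S -sumrB; apply: eq_bigr => u _.
    rewrite /s (bigID (mem N)) /= addrAC subrr add0r.
    by apply: eq_bigl => v; rewrite finset.in_setC.
  rewrite -[#|~: N|%:Z]natz expr2 [X in _ <= X]mulr_natr -sumr_const.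
  apply: ler_sum => u _; rewrite -sumr_const.
  by apply: ler_sum => v _; have /andP[] := wge u v.
rewrite SM -(ler_int rat) mulrNz !intrM intrB -expr2.
apply: (@sed_numeric_bound _ _ #|~: N|%:~R k%:~R); rewrite ?ler0z //.
- by rewrite /k; lia.
- by rewrite ler_int; have := cardsC N; lia.
- by rewrite expr2 -intrM ler_int -expr2.
- by rewrite -intrB -intrM ler_int.
- by rewrite -intrD expr2 -intrM ler_int -expr2.
Qed.

(** * SED-pairs from symmetric weight matrices *)

Section PairOfWeights.
Variables (T : finType) (w : T -> T -> int).
Hypotheses (wC : forall u v, w u v = w v u) (w0 : forall u, w u u = 0).
Hypothesis w1 : forall u v, [\/ w u v = 0, w u v = 1 | w u v = -1].
Hypothesis wP : forall u v, w u v != 0 ->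
  1 + w u v <= \sum_x w u x + \sum_x w v x.

Definition weight_graph : sgraph T.
Proof.
by apply: (@SGraph T (fun u v => w u v != 0)) => [u v|u]; rewrite 1?wC ?w0 ?eqxx.
Defined.

(** The picked pair is determined by [e] up to order, so the symmetry of [w] makes the choice
    harmless. *)
Definition weight_fun (e : {set T}) : int :=
  if [pick uv : T * T | e == [set uv.1; uv.2]] is Some uv then w uv.1 uv.2
  else 0.

Lemma weight_funE u v : weight_fun [set u; v] = w u v.
Proof.
rewrite /weight_fun; case: pickP => [[x y] /= /eqP E|/(_ (u, v))]; last first.
  by rewrite eqxx.
have : x \in [set u; v] by rewrite E !inE eqxx.
have : y \in [set u; v] by rewrite E !inE eqxx orbT.
have : u \in [set x; y] by rewrite -E !inE eqxx.
have : v \in [set x; y] by rewrite -E !inE eqxx orbT.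
rewrite !inE.
by move=> /orP[]/eqP ? /orP[]/eqP ? /orP[]/eqP ? /orP[]/eqP ?; subst; rewrite // wC.
Qed.

Lemma edge_weight_graphE u v : edge_weight weight_graph weight_fun u v = w u v.
Proof. by rewrite /edge_weight /= weight_funE; case: eqP => [->|]. Qed.

Lemma weight_graph_sed : is_sed_fun weight_graph weight_fun.
Proof.
split=> e /edgesP[u [v [/= uv ->]]].
  by rewrite weight_funE; move: uv; case: (w1 u v) => ->; auto.
have sumE x : \sum_y edge_weight weight_graph weight_fun x y = \sum_y w x y.
  by apply: eq_bigr => y _; rewrite edge_weight_graphE.
rewrite sum_closed_edge_nbhd // edge_weight_graphE !sumE.
by have := wP uv; lia.
Qed.

Lemma weight_pair : exists P : sed_pair,
  sed_order P = #|T| /\ 2 * sed_sum P = \sum_u \sum_v w u v.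
Proof.
exists (SedPair weight_graph_sed); split=> //.
rewrite /sed_sum /= -sum_edge_weight.
by apply: eq_bigr => u _; apply: eq_bigr => v _; rewrite edge_weight_graphE.
Qed.

End PairOfWeights.

(** * The construction from a Pell solution *)

Section PellPair.
Variables (r q : nat).
Local Notation p := r.+1.
Hypotheses (q_gt0 : (0 < q)%N) (pell : (p ^ 2 = 2 * q ^ 2 + 1)%N).

(* The isolated vertex, then [K], [R] and [N]. *)
Definition pell_vertex : finType :=
  (unit + 'I_p * 'I_(2 * q) + 'I_p * 'I_(2 * p) + 'I_p * 'I_(2 * (p + q)))%type.

(* The addition is that of the cyclic group ['I_p]. *)
Definition near (i j : 'I_p) : int := if (val (i + j)%R < q)%N then 1 else 0.

(** The negative edges are blow-ups of one circulant relation on first coordinates: a vertex is near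
    exactly q m elements of 'I_p * 'I_m. Using i + j instead of i - j makes [near] symmetric, at the
    price of loops, which are removed in [R]. *)
Definition pell_weight (u v : pell_vertex) : int :=
  match u, v with
  | inl (inl (inr x)), inl (inl (inr y)) => if x == y then 0 else 1
  | inl (inl (inr _)), inl (inr _) | inl (inr _), inl (inl (inr _)) => 1
  | inl (inl (inr x)), inr y => - near x.1 y.1
  | inr y, inl (inl (inr x)) => - near y.1 x.1
  | inl (inr x), inl (inr y) => if x == y then 0 else - near x.1 y.1
  | _, _ => 0
  end.

Definition pell_deg (u : pell_vertex) : int :=
  match u with
  | inl (inl (inl _)) => 0
  | inl (inl (inr _)) => p%:Z ^+ 2
  | inl (inr x) => near x.1 x.1
  | inr _ => - (2 * q%:Z ^+ 2)
  end.

Lemma pell_leq : (q <= r)%N.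
Proof. by rewrite -ltnS -(ltn_exp2r _ _ (isT : 0 < 2)%N) pell; lia. Qed.

Lemma nearC i j : near i j = near j i.
Proof. by rewrite /near addrC. Qed.

Lemma near01 i j : near i j = 0 \/ near i j = 1.
Proof. by rewrite /near; case: ifP; auto. Qed.

Lemma sum_near i : \sum_j near i j = q%:Z.
Proof.
(* Translating by -i turns the row into the indicator of the values below [q], and q < p. *)
rewrite (reindex_inj (addrI (- i))) /= /near.
under eq_bigr => j _ do rewrite addNKr.
rewrite -big_mkcond /=.
rewrite -(big_ord_widen p (fun=> 1)) ?(leqW pell_leq) //.
by rewrite sumr_const card_ord natz.
Qed.

Lemma sum_near_pair m i : \sum_(y : 'I_p * 'I_m) near i y.1 = q%:Z * m%:Z.
Proof.
rewrite -(pair_bigA _ (fun j _ => near i j)) /=.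
under eq_bigr do rewrite sumr_const card_ord -mulr_natr.
by rewrite -mulr_suml sum_near natz.
Qed.

Lemma sum_const_pair m (c : int) :
  \sum_(y : 'I_p * 'I_m) c = p%:Z * m%:Z * c.
Proof. by rewrite sumr_const card_prod !card_ord -mulr_natl natrM !natz. Qed.

Lemma sum_skip (I : finType) (F : I -> int) x :
  \sum_y (if x == y then 0 else F y) = \sum_y F y - F x.
Proof.
rewrite [in RHS](bigD1 x) //= addrAC subrr add0r (bigD1 x) //= eqxx add0r.
by apply: eq_bigr => y; rewrite eq_sym => /negbTE->.
Qed.

Lemma sum_pell_vertex (F : pell_vertex -> int) :
  \sum_u F u = F (inl (inl (inl tt))) + \sum_x F (inl (inl (inr x)))
               + \sum_x F (inl (inr x)) + \sum_x F (inr x).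
Proof.
rewrite !big_sumType /=; do 3!congr (_ + _).
by rewrite (big_pred1 tt) => //; case.
Qed.

(** On [K]: (2pq - 1) + 2p^2 - 2q(p + q) = p^2 by the Pell equation. On [R] the positive and
    negative edges cancel up to the deleted loop. *)
Lemma sum_pell_weight u : \sum_v pell_weight u v = pell_deg u.
Proof.
have pellZ : p%:Z ^+ 2 = 2 * q%:Z ^+ 2 + 1 by lia.
rewrite sum_pell_vertex /pell_weight.
case: u => [[[_|x]|x]|x] /=; rewrite ?sum_skip ?sumrN ?sum_near_pair
  ?sum_const_pair ?big1 ?PoszM ?PoszD //; lia.
Qed.

Lemma pell_pair : exists P : sed_pair, sed_order P = (4 * (p + q) * p + 1)%N /\
  sed_sum P <= - p%:Z ^+ 4 + 2 * p%:Z ^+ 2 + p%:Z * q%:Z.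
Proof.
have pellZ : p%:Z ^+ 2 = 2 * q%:Z ^+ 2 + 1 by lia.
have [||||P [Pn Ps]] := @weight_pair pell_vertex pell_weight.
- by move=> [[[?|?]|?]|?] [[[?|?]|?]|?] //=;
    rewrite 1?[in RHS]eq_sym // 1?nearC.
- by move=> [[[?|?]|?]|?] //=; rewrite eqxx.
- move=> [[[?|x]|x]|x] [[[?|y]|y]|y] /=; try case: eqP => _;
  try (case: (near01 x.1 y.1) => ->); rewrite ?oppr0;
  by [apply: Or31|apply: Or32|apply: Or33].
- move=> u v; rewrite !sum_pell_weight.
  (* This gives p^2 >= 3, enough for the positive edges between [K] and [R]; the negative edges
     between [K] and [N] use p^2 - 2q^2 = 1. *)
  have q1 : 1 <= q%:Z ^+ 2 by nia.
  rewrite /pell_deg pellZ; move: (q%:Z ^+ 2) q1 => Q Q1.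
  move: u v => [[[?|x]|x]|x] [[[?|y]|y]|y] //=; try (case: (x =P y) => _ //);
  move: (near01 x.1 y.1) (near01 x.1 x.1) (near01 y.1 y.1);
  move: (near x.1 y.1) (near x.1 x.1) (near y.1 y.1) => a b c; lia.
exists P; split.
  by rewrite Pn !card_sum !card_prod !card_ord card_unit; lia.
move: Ps; under eq_bigr do rewrite sum_pell_weight.
rewrite sum_pell_vertex /= !sum_const_pair !PoszM PoszD.
have : \sum_(x : 'I_p * 'I_(2 * p)) near x.1 x.1 <= p%:Z * (2 * p%:Z).
  rewrite -[X in _ <= X]mulr1 -(PoszM 2) -sum_const_pair; apply: ler_sum => x _.
  by case: (near01 x.1 x.1) => ->.
move: (\sum_(x : 'I_p * 'I_(2 * p)) _) => S.
move: (sed_sum P) (p%:Z) pellZ => s x pellZ SP Ps.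
have {}Ps : 2 * s = S - 2 * x ^+ 4 + 2 * x ^+ 2 + 2 * (x * q%:Z).
  rewrite Ps; have -> : 2 * q%:Z ^+ 2 = x ^+ 2 - 1 by rewrite pellZ addrK.
  by ring.
have {}SP : S <= 2 * x ^+ 2 by rewrite expr2 mulrCA.
move: (x ^+ 4) (x ^+ 2) (x * q%:Z) SP Ps => ? ? ? ? ?; lia.
Qed.

End PellPair.

(** * Bounds for SED-pairs and the asymptotics *)

Lemma sed_sum_bound (P : sed_pair) :
  - (sed_order P)%:Z ^+ 2 <= 25 * sed_sum P.
Proof.
have [f1 fP] := sed_funP P.
have := @sed_weight_bound _ (edge_weight (sed_graph P) (sed_fun P)).
rewrite sum_edge_weight -/(sed_sum P) -/(sed_order P).
suff H x y : 2 * x <= 25 * (2 * y) -> x <= 25 * y :> int.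
  move=> /(_ (edge_weightC _ _)) B; apply: H; rewrite mulrN; apply: B.
    move=> u v; rewrite /edge_weight; case: ifP => // uv.
    by case: (f1 [set u; v]) => [|->|->] //; apply/edgesP; exists u, v.
  move=> u v; rewrite {1}/edge_weight; case: ifP => // uv _.
  have uvE : [set u; v] \in edges (sed_graph P) by apply/edgesP; exists u, v.
  have := fP _ uvE; rewrite sum_closed_edge_nbhd // lerBrDr.
  by have -> : edge_weight (sed_graph P) (sed_fun P) u v = sed_fun P [set u; v]
    by rewrite /edge_weight uv.
lia.
Qed.

(** The right-hand side equals n - n^2 / (8 (1 + sqrt 2)^2); its slack n = 4p^2 + 4pq + 1 absorbs
    the lower-order terms. *)
Lemma pell_real_bound (R : rcfType) (p q n : R) :
  0 < p -> 0 < q -> p ^+ 2 = 2 * q ^+ 2 + 1 -> n = 4 * (p + q) * p + 1 ->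
  - p ^+ 4 + 2 * p ^+ 2 + p * q <
  - ((1 - 8 * (1 + Num.sqrt 2) ^+ 2 / n) *
     (n ^+ 2 / (8 * (1 + Num.sqrt 2) ^+ 2))).
Proof.
move=> p0 q0 pell nE; pose z : R := Num.sqrt 2.
have z2 : z ^+ 2 = 2 by rewrite sqr_sqrtr.
have z0 : 0 < z by rewrite sqrtr_gt0.
rewrite -/z.
have n0 : 0 < n by rewrite nE; nra.
have c0 : 0 < (1 + z) ^+ 2 by nra.
have -> : - ((1 - 8 * (1 + z) ^+ 2 / n) * (n ^+ 2 / (8 * (1 + z) ^+ 2))) =
  n - n ^+ 2 / (8 * (1 + z) ^+ 2).
  by field; rewrite ?gt_eqF //; lra.
(* [t] is [n] with [q] replaced by its upper bound [p / sqrt 2]. *)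
pose t := 2 * z * (1 + z) * p ^+ 2 + 1.
have zq : z * q < p by rewrite -(ltr_pXn2r (isT : 0 < 2)%N) ?nnegrE ?exprMn ?z2; nra.
have nt : n < t by rewrite /t nE; nra.
have : n ^+ 2 / (8 * (1 + z) ^+ 2) < t ^+ 2 / (8 * (1 + z) ^+ 2).
  rewrite ltr_pM2r ?invr_gt0; nra.
(* Since z^2 = 2, the leading term of the quotient is exactly p^4. *)
have : t ^+ 2 / (8 * (1 + z) ^+ 2) <= p ^+ 4 + p ^+ 2 + 1.
  rewrite ler_pdivrMr; last by lra.
  have -> : t ^+ 2 = 4 * z ^+ 2 * ((1 + z) ^+ 2 * p ^+ 4)
      + 4 * z * (1 + z) * p ^+ 2 + 1 by rewrite /t; ring.
  rewrite z2; have : 4 * z * (1 + z) <= 8 * (1 + z) ^+ 2 by nra.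
  move=> /(ler_wpM2r (sqr_ge0 p)); have : 1 <= (1 + z) ^+ 2 by nra.
  lra.
move=> h1 h2.
have : p ^+ 4 + p ^+ 2 + 1 + p * q + 2 * p ^+ 2 <= n + p ^+ 4.
  by rewrite nE; nra.
lra.
Qed.

Local Open Scope classical_set_scope.
Local Open Scope ring_scope.

Theorem theorem2 (R : realType) :
  (forall n : nat, (0 < n)%N -> - (n%:R ^+ 2 / 25%:R) <= (g n)%:~R :> R) /\
  (exists eps : nat -> R,
     eps n @[n --> within pell_order \oo] --> (0 : R) /\
     forall n : nat, pell_order n ->
       exists P : sed_pair, sed_order P = n /\
         (sed_sum P)%:~R <
           - ((1 + eps n) * (n%:R ^+ 2 / (8%:R * (1 + Num.sqrt 2%:R) ^+ 2)))).
Proof.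
split=> [n _|].
  have [[P [Pn <-]] _] := g_is_min n.
  have := sed_sum_bound P; rewrite Pn -(ler_int R) mulrNz expr2 !intrM => B.
  by rewrite lerNl ler_pdivlMr // mulrC mulrN lerNl expr2.
(* This choice weakens the main term by exactly [n]; it tends to 0 along all integers, hence along
   the Pell orders. *)
exists (fun n => - (8%:R * (1 + Num.sqrt 2%:R) ^+ 2 / n%:R)); split.
  apply: cvg_within_filter.
  have inv0 : (n%:R : R)^-1 @[n --> \oo] --> (0 : R).
    apply/gtr0_cvgV0; last exact: cvgr_idn.
    by near=> n; rewrite ltr0n; near: n; exists 1%N.
  have := cvgN (cvgM (cvg_cst (8%:R * (1 + Num.sqrt 2%:R) ^+ 2 : R)) inv0).
  by rewrite mulr0 oppr0; apply.
move=> n [[|p] [q [// _ q0 pell ->]]].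
have [P [Pn Ps]] := pell_pair q0 pell.
exists P; split=> //.
apply: le_lt_trans (pell_real_bound (p := p.+1%:R) (q := q%:R) _ _ _ _).
- move: Ps; rewrite -(ler_int R) !(intrD, intrM, mulrNz) => Ps.
  exact: Ps.
- by rewrite ltr0n.
- by rewrite ltr0n.
- by rewrite -!natrX -natrM natr1 pell addn1.
- by rewrite -natrD -!natrM natr1 addn1.
Unshelve. all: by end_near. Qed.
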